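(* Let $K$ be a commutative ring with $\frac12\in K$ and let $n\ge1$. Let $\mathcal F_n(K)=\{I: I_0\subseteq I_1\subseteq\cdots\subseteq I_n\mid I_i\text{ are ideals of }K\}$ be the set of $n$-flags of ideals of $K$, and let $\mathrm{DI}(\Lambda_n)$ be the set of all differential ideals of $\Lambda_n=\Lambda_n(K)$. Then the map $$\mathcal F_n(K)\to \mathrm{DI}(\Lambda_n),\qquad I\mapsto \widehat I:=\bigoplus_{i=0}^n\bigoplus_{|\alpha|=i}I_i x^\alpha,$$ is a bijection. In particular, $\mathfrak m^i$, $0\le i\le n+1$, are differential ideals of $\Lambda_n$; these are the only differential ideals of $\Lambda_n$ if $K$ is a field of characteristic $\ne2$.
   Context: $\Lambda_n=\Lambda_n(K)=K\lfloor x_1,\ldots,x_n\rfloor$ is the Grassmann algebra: the $K$-algebra with generators $x_1,\ldots,x_n$ and defining relations $x_i^2=0$, $x_ix_j=-x_jx_i$ ($i\ne j$); it is a free $K$-module with basis $x^\alpha=x_1^{\alpha_1}\cdots x_n^{\alpha_n}$, $\alpha\in\{0,1\}^n$, and $|\alpha|=\alpha_1+\cdots+\alpha_n$. $\mathfrak m=\bigoplus_{|\alpha|\ge1}Kx^\alpha$ is the augmentation ideal. An ideal $\mathfrak a$ of $\Lambda_n$ is a differential ideal if $\delta(\mathfrak a)\subseteq\mathfrak a$ for every $K$-derivation $\delta$ of $\Lambda_n$. *)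

(* Defs.v *)
From HB Require Import structures.
From mathcomp Require Import boolp classical_sets functions.
From mathcomp Require Import all_boot all_order all_algebra.

Set Implicit Arguments.
Unset Strict Implicit.
Unset Printing Implicit Defensive.

Import Order.TTheory GRing.Theory.
Local Open Scope ring_scope.

(* An element of the Grassmann algebra is stored as its family of coordinates
   in the monomial basis x^alpha; an exponent alpha in {0,1}^n is identified
   with its support A, a subset of 'I_n, so that |alpha| = #|A|. *)
Definition grassmann (n : nat) (K : comPzRingType) : Type :=
  {ffun {set 'I_n} -> K}.

HB.instance Definition _ n K := GRing.Zmodule.on (grassmann n K).

Section GrassmannRing.
Variables (n : nat) (K : comPzRingType).
Implicit Types (A B C S : {set 'I_n}) (f g h : grassmann n K).

(* For disjoint A and B, sorting the product x^A x^B into increasing order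
   takes one transposition per pair (a, b) in A * B with b < a. *)
Definition inversions A B : nat := \sum_(a in A) \sum_(b in B) (b < a)%N.

Definition gr_scale (k : K) f : grassmann n K := [ffun S => k * f S].

Definition gr_one : grassmann n K := [ffun S => (S == set0)%:R].

Definition gr_mul f g : grassmann n K :=
  [ffun S : {set 'I_n} => \sum_(A : {set 'I_n} | A \subset S)
     (-1) ^+ inversions A (S :\: A) * f A * g (S :\: A)].

Lemma inversionsUl A B C : [disjoint A & B] ->
  inversions (A :|: B) C = (inversions A C + inversions B C)%N.
Proof.
move=> dAB; rewrite /inversions -bigU //; apply: eq_bigl => i.
by rewrite !inE.
Qed.

Lemma inversionsUr A B C : [disjoint B & C] ->
  inversions A (B :|: C) = (inversions A B + inversions A C)%N.
Proof.
move=> dBC; rewrite /inversions -big_split /=; apply: eq_bigr => a _.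
by rewrite -bigU //; apply: eq_bigl => i; rewrite !inE.
Qed.

Lemma inversions0l A : inversions set0 A = 0%N.
Proof. by rewrite /inversions big_set0. Qed.

Lemma inversions0r A : inversions A set0 = 0%N.
Proof. by rewrite /inversions big1 // => a _; rewrite big_set0. Qed.

Lemma gr_mulA : associative gr_mul.
Proof.
move=> f g h; apply/ffunP => S; rewrite !ffunE.
under eq_bigr => B _ do rewrite ffunE mulr_sumr.
under [RHS]eq_bigr => A _ do rewrite ffunE mulr_sumr mulr_suml.
rewrite [RHS](exchange_big_dep (fun B => B \subset S)) /=; last first.
  by move=> A B sAS sBA; apply: subset_trans sAS.
apply: eq_bigr => B sBS.
rewrite [RHS](reindex_onto (fun C => B :|: C) (fun A => A :\: B)) /=;
  last first.
  move=> A /andP[_ sBA]; apply/setP => i; rewrite !inE.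
  by case: (boolP (i \in B)) => //= iB; rewrite (subsetP sBA).
apply: eq_big => [C|C sC].
  rewrite subsetD subUset sBS subsetUl andbT /=; congr (_ && _).
  apply/idP/eqP => [dCB|<-].
    rewrite setDUl setDv set0U; apply/setDidPl.
    exact: dCB.
  by rewrite disjoint_sym disjoints_subset; apply/subsetP => i iB; rewrite !inE iB.
have dCB : [disjoint C & B] by move: sC; rewrite subsetD => /andP[].
have sCS : C \subset S by move: sC; rewrite subsetD => /andP[].
have dBC : [disjoint B & C] by rewrite disjoint_sym.
set D := S :\: (B :|: C).
have -> : (S :\: B) :\: C = D by rewrite /D -setDDl.
have -> : (B :|: C) :\: B = C.
  by rewrite setDUl setDv set0U; apply/setDidPl.
have dCD : [disjoint C & D].
  by rewrite disjoints_subset; apply/subsetP => i iC; rewrite !inE iC orbT.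
have -> : S :\: B = C :|: D.
  apply/setP => i; rewrite !inE.
  case: (boolP (i \in C)) => //= iC; last by rewrite orbF.
  by rewrite (subsetP sCS) // (disjointFr dCB).
rewrite inversionsUl // inversionsUr // !exprD.
move: (_ ^+ inversions B C) (_ ^+ inversions B D) (_ ^+ inversions C D) => p q r.
rewrite !mulrA; congr (_ * _ * _).
by rewrite mulrAC -(mulrA p) (mulrC p).
Qed.

Lemma gr_mul1l : left_id gr_one gr_mul.
Proof.
move=> f; apply/ffunP => S; rewrite ffunE (bigD1 set0) ?sub0set //= big1.
  by rewrite ffunE eqxx inversions0l setD0 addr0 !mul1r.
by move=> A /andP[_ /negPf A0]; rewrite ffunE A0 mulr0 mul0r.
Qed.

Lemma gr_mul1r : right_id gr_one gr_mul.
Proof.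
move=> f; apply/ffunP => S; rewrite ffunE (bigD1 S) //= big1.
  by rewrite ffunE setDv eqxx inversions0r addr0 mul1r mulr1.
move=> A /andP[sAS nAS]; rewrite ffunE setD_eq0.
case: (boolP (S \subset A)) => [sSA|_]; last by rewrite mulr0.
by rewrite eqEsubset sAS sSA in nAS.
Qed.

Lemma gr_mulDl : left_distributive gr_mul +%R.
Proof.
move=> f g h; apply/ffunP => S; rewrite !ffunE -big_split /=.
by apply: eq_bigr => A _; rewrite ffunE mulrDr mulrDl.
Qed.

Lemma gr_mulDr : right_distributive gr_mul +%R.
Proof.
move=> f g h; apply/ffunP => S; rewrite !ffunE -big_split /=.
by apply: eq_bigr => A _; rewrite ffunE mulrDr.
Qed.

Lemma gr_scaleA a b f : gr_scale a (gr_scale b f) = gr_scale (a * b) f.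
Proof. by apply/ffunP => S; rewrite !ffunE mulrA. Qed.

Lemma gr_scale1 : left_id 1 gr_scale.
Proof. by move=> f; apply/ffunP => S; rewrite !ffunE mul1r. Qed.

Lemma gr_scaleDr : right_distributive gr_scale +%R.
Proof. by move=> k f g; apply/ffunP => S; rewrite !ffunE mulrDr. Qed.

Lemma gr_scaleDl f : {morph gr_scale^~ f : a b / a + b}.
Proof. by move=> a b; apply/ffunP => S; rewrite !ffunE mulrDl. Qed.

HB.instance Definition _ := GRing.Zmodule_isPzRing.Build (grassmann n K)
  gr_mulA gr_mul1l gr_mul1r gr_mulDl gr_mulDr.

HB.instance Definition _ := GRing.Zmodule_isLmodule.Build K (grassmann n K)
  gr_scaleA gr_scale1 gr_scaleDr gr_scaleDl.

Lemma gr_mulE f g S : (f * g) S = \sum_(A : {set 'I_n} | A \subset S)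
  (-1) ^+ inversions A (S :\: A) * f A * g (S :\: A).
Proof. by rewrite ffunE. Qed.

Lemma gr_scaleE (k : K) f S : (k *: f) S = k * f S.
Proof. by rewrite ffunE. Qed.

Lemma gr_scaleAl (k : K) f g : k *: (f * g) = (k *: f) * g.
Proof.
apply/ffunP => S; rewrite gr_scaleE !gr_mulE mulr_sumr.
by apply: eq_bigr => A _; rewrite gr_scaleE !mulrA (mulrC k).
Qed.

Lemma gr_scaleAr (k : K) f g : k *: (f * g) = f * (k *: g).
Proof.
apply/ffunP => S; rewrite gr_scaleE !gr_mulE mulr_sumr.
by apply: eq_bigr => A _; rewrite gr_scaleE mulrCA.
Qed.

End GrassmannRing.

Lemma gr_one_neq0 n (K : comNzRingType) : (1 : grassmann n K) != 0.
Proof.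
apply/eqP => /ffunP /(_ set0); rewrite !ffunE eqxx => /eqP.
by rewrite oner_eq0.
Qed.

HB.instance Definition _ n (K : comNzRingType) :=
  GRing.PzSemiRing_isNonZero.Build (grassmann n K) (gr_one_neq0 n K).
HB.instance Definition _ n (K : comNzRingType) :=
  GRing.Lmodule_isLalgebra.Build K (grassmann n K) (@gr_scaleAl n K).
HB.instance Definition _ n (K : comNzRingType) :=
  GRing.Lalgebra_isAlgebra.Build K (grassmann n K) (@gr_scaleAr n K).

(* The product is taken in increasing order of the indices. *)
Definition monomial n (R : pzRingType) (y : 'I_n -> R) (A : {set 'I_n}) : R :=
  \prod_(i in A) y i.

Lemma min_set_ind n (P : {set 'I_n} -> Prop) : P set0 ->
  (forall (i : 'I_n) (A : {set 'I_n}), (forall a, a \in A -> (i < a)%N) ->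
     P A -> P (i |: A)) ->
  forall A, P A.
Proof.
move=> P0 PU A; have [m] := ubnP #|A|; elim: m A => // m IHm A leA.
have [->//|[i0 i0A]] := set_0Vmem A.
case: (arg_minnP (fun i : 'I_n => nat_of_ord i) i0A) => i iA' imin.
have iA : i \in A by [].
rewrite -(setD1K iA); apply: PU => [a|].
  by rewrite !inE => /andP[nai /imin leia]; rewrite ltn_neqAle leia andbT eq_sym.
by apply: IHm; rewrite (cardsD1 i) iA in leA.
Qed.

Section Monomials.
Variables (n : nat) (R : pzRingType) (y : 'I_n -> R).
Implicit Types (A B : {set 'I_n}).

Lemma monomial0 : monomial y set0 = 1.
Proof. by rewrite /monomial big_set0. Qed.

Lemma monomial_cons (i : 'I_n) A : (forall a, a \in A -> (i < a)%N) ->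
  monomial y (i |: A) = y i * monomial y A.
Proof.
move=> ltiA; rewrite /monomial -[LHS]big_filter -[in RHS]big_filter.
pose s (B : {set 'I_n}) := [seq a <- index_enum 'I_n | a \in B].
suff : s (i |: A) = i :: s A by rewrite /s => ->; rewrite big_cons.
have ltT : transitive (fun a b : 'I_n => a < b)%N by move=> a b c; apply: ltn_trans.
have ltI : irreflexive (fun a b : 'I_n => a < b)%N by move=> a; apply: ltnn.
have srt B : sorted (fun a b : 'I_n => a < b)%N (s B).
  apply: sorted_filter => //; rewrite [index_enum _]unlock -enumT.
  by have := iota_ltn_sorted 0 n; rewrite -val_enum_ord sorted_map.
apply: (irr_sorted_eq ltT ltI) => //.
  rewrite /= path_sortedE // srt andbT; apply/allP => a.
  by rewrite mem_filter => /andP[/ltiA].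
by move=> a; rewrite in_cons !mem_filter !inE !mem_index_enum !andbT.
Qed.

Lemma monomial1 (i : 'I_n) : monomial y [set i] = y i.
Proof.
rewrite -(setU0 [set i]) monomial_cons ?monomial0 ?mulr1 // => a.
by rewrite inE.
Qed.

Hypothesis ysq : forall i, y i * y i = 0.
Hypothesis yanti : forall i j, i != j -> y i * y j = - (y j * y i).

Lemma inversions1_lt (i : 'I_n) A : (forall a, a \in A -> (i < a)%N) ->
  inversions [set i] A = 0%N.
Proof.
move=> ltiA; rewrite /inversions big_set1 big1 // => a /ltiA ltia.
by rewrite ltnNge ltnW.
Qed.

Lemma inversions11 (i j : 'I_n) : inversions [set i] [set j] = (j < i)%N.
Proof. by rewrite /inversions !big_set1. Qed.

Lemma disjoint1_lt (i : 'I_n) A : (forall a, a \in A -> (i < a)%N) -> i \notin A.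
Proof. by move=> ltiA; apply/negP => /ltiA; rewrite ltnn. Qed.

Lemma gen_monomial (i : 'I_n) A : y i * monomial y A =
  if i \in A then 0 else (-1) ^+ inversions [set i] A * monomial y (i |: A).
Proof.
elim/min_set_ind: A => [|j A ltjA IHA].
  by rewrite inE inversions0r mul1r setU0 monomial1 monomial0 mulr1.
have njA := disjoint1_lt ltjA.
rewrite !inE monomial_cons //.
case: (eqVneq i j) => [->|neq] /=; first by rewrite mulrA ysq mul0r.
have [ltij|leji] := ltnP i j.
  have lti a : a \in j |: A -> (i < a)%N.
    by rewrite !inE => /orP[/eqP->|/ltjA /(ltn_trans ltij)].
  have /negPf := disjoint1_lt lti; rewrite !inE (negPf neq) /= => ->.
  by rewrite inversions1_lt // mul1r !monomial_cons.
have ltji : (j < i)%N.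
  by rewrite ltn_neqAle leji andbT; apply: contraNneq neq => /ord_inj ->.
rewrite mulrA yanti // mulNr -mulrA IHA; case: ifP => iA; first by rewrite mulr0 oppr0.
rewrite inversionsUr ?disjoints1 // inversions11 ltji exprD expr1 mulN1r mulNr.
congr (- _); rewrite mulrA (commr_sign (y j)) -mulrA; congr (_ * _).
rewrite setUCA [RHS]monomial_cons // => a; rewrite !inE => /orP[/eqP->//|].
exact: ltjA.
Qed.

Lemma monomialM A B : monomial y A * monomial y B =
  if [disjoint A & B] then (-1) ^+ inversions A B * monomial y (A :|: B) else 0.
Proof.
elim/min_set_ind: A => [|i A ltiA IHA].
  by rewrite inversions0l !mul1r monomial0 mul1r set0U disjoints_subset sub0set.
have niA := disjoint1_lt ltiA.
rewrite monomial_cons // -mulrA IHA.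
have -> : [disjoint i |: A & B] = (i \notin B) && [disjoint A & B].
  by rewrite -disjointU1; apply: eq_disjoint => a; rewrite !inE.
case: ifP => dAB; last by rewrite andbF mulr0.
rewrite andbT mulrA (commr_sign (y i)) -mulrA gen_monomial inE (negPf niA) /=.
case: (boolP (i \in B)) => iB /=; first by rewrite mulr0.
rewrite setUA inversionsUr // inversions1_lt // add0n.
by rewrite inversionsUl ?disjoints1 // addnC exprD !mulrA.
Qed.

End Monomials.

Definition gr_gen n (K : comPzRingType) (i : 'I_n) : grassmann n K :=
  [ffun S => (S == [set i])%:R].

Definition gr_mon n (K : comPzRingType) (A : {set 'I_n}) : grassmann n K :=
  monomial (@gr_gen n K) A.

Section GrassmannPresentation.
Variables (n : nat) (K : comPzRingType).
Implicit Types (i j : 'I_n) (A S : {set 'I_n}) (f : grassmann n K).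

Lemma gr_genM i f S : (gr_gen K i * f) S =
  if i \in S then (-1) ^+ inversions [set i] (S :\ i) * f (S :\ i) else 0.
Proof.
rewrite gr_mulE; case: ifP => iS; last first.
  rewrite big1 // => A sAS; rewrite ffunE; case: eqP => [eA|]; last by rewrite mulr0 mul0r.
  by rewrite eA sub1set iS in sAS.
rewrite (bigD1 [set i]) ?sub1set //= big1 ?addr0; last first.
  by move=> A /andP[_ /negPf neA]; rewrite ffunE neA mulr0 mul0r.
by rewrite ffunE eqxx mulr1.
Qed.

Lemma gr_gen_sq i : gr_gen K i * gr_gen K i = 0.
Proof.
apply/ffunP => S; rewrite gr_genM !ffunE; case: ifP => // iS.
case: eqP => [/setP/(_ i)|]; last by rewrite mulr0.
by rewrite !inE eqxx.
Qed.

Lemma gr_gen_anti i j : i != j ->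
  gr_gen K i * gr_gen K j = - (gr_gen K j * gr_gen K i).
Proof.
move=> neij; have neji : j != i by rewrite eq_sym.
have E a b S : a != b -> (gr_gen K a * gr_gen K b) S =
    (S == [set a; b])%:R * (-1) ^+ (b < a)%N.
  move=> neab; rewrite gr_genM ffunE; case: (eqVneq S [set a; b]) => [->|neS].
    rewrite !inE eqxx /= setU1K ?inE // eqxx inversions11.
    by rewrite mul1r mulr1.
  case: ifP => aS; last by rewrite mul0r.
  case: eqP => [eS|_]; last by rewrite mul0r mulr0.
  by rewrite -eS setD1K // eqxx in neS.
have oppE f S : (- f) S = - f S by rewrite ffunE.
apply/ffunP => S; rewrite oppE !E // [[set j; i]]setUC.
rewrite -mulrN; congr (_ * _).
by case: (ltngtP i j) neij => [_|_|/ord_inj ->]; rewrite ?eqxx ?expr1 ?expr0 ?opprK.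
Qed.

Lemma gr_monE A S : gr_mon K A S = (S == A)%:R.
Proof.
rewrite /gr_mon; elim/min_set_ind: A S => [|i A ltiA IHA] S.
  by rewrite monomial0 ffunE.
have niA := disjoint1_lt ltiA.
rewrite monomial_cons // gr_genM IHA; case: ifP => iS; last first.
  by case: eqP => // eS; rewrite eS !inE eqxx in iS.
case: (eqVneq S (i |: A)) => [->|neS].
  by rewrite setU1K // eqxx inversions1_lt // mul1r.
case: eqP => [eS|]; last by rewrite mulr0.
by rewrite -eS setD1K // eqxx in neS.
Qed.

Lemma gr_sumE (c : {set 'I_n} -> K) S : (\sum_A c A *: gr_mon K A) S = c S.
Proof.
rewrite sum_ffunE (bigD1 S) //= gr_scaleE gr_monE eqxx mulr1 big1 ?addr0 //.
by move=> A /negPf neA; rewrite gr_scaleE gr_monE eq_sym neA mulr0.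
Qed.

(* The monomials x^alpha form a K-basis. *)
Lemma gr_basis f :
  exists! c : {ffun {set 'I_n} -> K}, f = \sum_A c A *: gr_mon K A.
Proof.
exists f; split=> [|c ->]; last by apply/ffunP => S; rewrite gr_sumE.
by apply/ffunP => S; rewrite gr_sumE.
Qed.

End GrassmannPresentation.

(* The universal property of the algebra presented by the generators x_i and
   the relations x_i^2 = 0, x_i x_j = - x_j x_i. *)
Lemma gr_universal n (K : comNzRingType) (R : algType K) (y : 'I_n -> R) :
  (forall i, y i * y i = 0) ->
  (forall i j, i != j -> y i * y j = - (y j * y i)) ->
  exists2 phi : {lrmorphism grassmann n K -> R},
    (forall i, phi (gr_gen K i) = y i)
  & forall psi : {lrmorphism grassmann n K -> R},
      (forall i, psi (gr_gen K i) = y i) -> psi =1 phi.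
Proof.
move=> ysq yanti.
pose ev (f : grassmann n K) : R := \sum_A f A *: monomial y A.
have ev_lin : linear ev.
  move=> k f g; rewrite /ev scaler_sumr -big_split /=; apply: eq_bigr => A _.
  by rewrite ffunE gr_scaleE scalerDl scalerA.
have ev_mon A : ev (gr_mon K A) = monomial y A.
  rewrite /ev (bigD1 A) //= gr_monE eqxx scale1r big1 ?addr0 // => B /negPf nB.
  by rewrite gr_monE nB scale0r.
pose evL : {linear grassmann n K -> R} :=
  HB.pack ev (GRing.isLinear.Build K (grassmann n K) R *:%R ev ev_lin).
have sumE (f : grassmann n K) : f = \sum_A f A *: gr_mon K A.
  by apply/ffunP => S; rewrite gr_sumE.
have ev_mul : monoid_morphism ev.
  split; first by rewrite -(monomial0 y) -ev_mon /gr_mon monomial0.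
  move=> f g; rewrite {1}(sumE f) {1}(sumE g) mulr_suml.
  rewrite -[ev _]/(evL _) linear_sum /ev mulr_suml; apply: eq_bigr => A _.
  rewrite !mulr_sumr linear_sum; apply: eq_bigr => B _.
  rewrite -!scalerAl -!scalerAr !linearZ /=.
  rewrite [LHS]scalerA (mulrC (f A)) -scalerA; congr (_ *: (_ *: _)).
  rewrite (monomialM ysq yanti).
  rewrite /gr_mon (monomialM (@gr_gen_sq n K) (@gr_gen_anti n K)).
  case: ifP => _; last exact: linear0 evL.
  rewrite -[in LHS]signr_odd -[in RHS]signr_odd !mulr_sign; case: ifP => _; rewrite -ev_mon //.
  by rewrite -[LHS]/(evL _) linearN.
pose phi : {lrmorphism grassmann n K -> R} :=
  HB.pack ev (GRing.isLinear.Build K (grassmann n K) R *:%R ev ev_lin)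
    (GRing.isMonoidMorphism.Build (grassmann n K) R ev ev_mul).
have genE i : gr_gen K i = gr_mon K [set i] by rewrite /gr_mon monomial1.
exists phi => [i|psi psiE f]; first by rewrite genE /= ev_mon monomial1.
rewrite {1}(sumE f) linear_sum; apply: eq_bigr => A _; rewrite linearZ /=; congr (_ *: _).
rewrite /gr_mon /monomial rmorph_prod; apply: eq_bigr => i _; exact: psiE.
Qed.

Local Open Scope classical_set_scope.

Definition is_ideal (R : pzRingType) (a : set R) : Prop :=
  [/\ a 0, forall u v, a u -> a v -> a (u + v)
    & forall r u, a u -> a (r * u) /\ a (u * r)].

Definition ideal_mul (R : pzRingType) (a b : set R) : set R :=
  [set z | exists2 s : seq (R * R),
     forall p, p \in s -> a p.1 /\ b p.2 & z = \sum_(p <- s) p.1 * p.2].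

Definition ideal_exp (R : pzRingType) (a : set R) (k : nat) : set R :=
  iter k (ideal_mul a) [set: R].

Section DifferentialIdeals.
Variables (n : nat) (K : comPzRingType).

Definition is_derivation (d : {linear grassmann n K -> grassmann n K}) : Prop :=
  forall f g, d (f * g) = d f * g + f * d g.

Definition differential_ideal (a : set (grassmann n K)) : Prop :=
  is_ideal a /\
  forall d : {linear grassmann n K -> grassmann n K},
    is_derivation d -> d @` a `<=` a.

(* An n-flag I_0 <= ... <= I_n is a function on the index set {0, ..., n}. *)
Definition is_flag (I : 'I_n.+1 -> set K) : Prop :=
  (forall i, is_ideal (I i)) /\
  (forall i j : 'I_n.+1, (i <= j)%N -> I i `<=` I j).

(* The index #|A| = |alpha| is at most n, so inord only casts it to 'I_n.+1. *)
Definition flag_hat (I : 'I_n.+1 -> set K) : set (grassmann n K) :=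
  [set f | exists2 c : {set 'I_n} -> K,
     forall A : {set 'I_n}, I (inord #|A|) (c A)
     & f = \sum_A c A *: gr_mon K A].

Definition augmentation_ideal : set (grassmann n K) :=
  [set f | exists c : {set 'I_n} -> K,
     f = \sum_(A : {set 'I_n} | (1 <= #|A|)%N) c A *: gr_mon K A].

End DifferentialIdeals.

Arguments is_flag : clear implicits.
Arguments differential_ideal : clear implicits.
Arguments flag_hat : clear implicits.
Arguments augmentation_ideal : clear implicits.

(* Main.v *)
(** The Euler-type derivations [x_i d/dx_i] act on the monomial basis as
    commuting projections, so a differential ideal contains every term
    [f_A x^A] of each of its elements; the derivations [x_i d/dx_j] move [x^A]
    to [+- x^B] for any [B] of the same cardinality, and multiplication by
    generators moves it upwards.  Hence a differential ideal is determined by an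
    increasing sequence of coefficient ideals.  Conversely, applying a
    derivation [d] to [x_i^2 = 0] gives [2 c x_i = 0] in degree one, where [c]
    is the constant term of [d x_i]; as [2] is invertible, [d x_i] lies in the
    augmentation ideal, so [d] does not lower degrees and preserves the ideal
    attached to a flag. *)
From HB Require Import structures.
Require Import Defs.
From mathcomp Require Import boolp classical_sets functions.
From mathcomp Require Import all_boot all_order all_algebra.

Import GRing.Theory.
Local Open Scope ring_scope.
Local Open Scope classical_set_scope.

Set Implicit Arguments.
Unset Strict Implicit.
Unset Printing Implicit Defensive.

(** * Closure of ideals; coordinates in the monomial basis *)

Lemma is_ideal_sum (R : pzRingType) (a : set R) (I : Type) (r : seq I)
    (P : pred I) (F : I -> R) :
  is_ideal a -> (forall i, P i -> a (F i)) -> a (\sum_(i <- r | P i) F i).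
Proof. by case=> a0 aD _ aF; apply: big_ind. Qed.

Lemma is_ideal_opp (R : pzRingType) (a : set R) (u : R) :
  is_ideal a -> a u -> a (- u).
Proof. by case=> _ _ aM /(aM (-1)) []; rewrite mulN1r. Qed.

Section GrassmannCoordinates.
Variables (n : nat) (K : comPzRingType).
Implicit Types (i j k : 'I_n) (A B S : {set 'I_n}) (f g : grassmann n K).

Lemma gr_addE f g S : (f + g) S = f S + g S.
Proof. by rewrite ffunE. Qed.

Lemma gr_oppE f S : (- f) S = - f S.
Proof. by rewrite ffunE. Qed.

Lemma gr_expand f : f = \sum_A f A *: gr_mon K A.
Proof. by apply/ffunP => S; rewrite gr_sumE. Qed.

Lemma gr_genE i : gr_gen K i = gr_mon K [set i].
Proof. by rewrite /gr_mon monomial1. Qed.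

Lemma gr_mon_cons i A : (forall a, a \in A -> (i < a)%N) ->
  gr_mon K (i |: A) = gr_gen K i * gr_mon K A.
Proof. exact: monomial_cons. Qed.

Lemma gr_genM_mon i A : i \notin A ->
  gr_mon K (i |: A) =
    (-1) ^+ inversions [set i] A *: (gr_gen K i * gr_mon K A).
Proof.
move=> /[dup] /negPf iA niA; apply/ffunP => S.
rewrite gr_scaleE gr_genM !gr_monE; case: (eqVneq S (i |: A)) => [->|neS].
  by rewrite !inE eqxx /= setU1K // eqxx mulr1 -expr2 sqrr_sign.
case: ifP => iS; last by rewrite mulr0.
case: eqP => [eS|_]; last by rewrite !mulr0.
by rewrite -eS setD1K // eqxx in neS.
Qed.

End GrassmannCoordinates.

(** * Partial derivatives and the derivations x_i d/dx_j *)

Section PartialDerivatives.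
Variables (n : nat) (K : comPzRingType).
Implicit Types (i j k : 'I_n) (A B S : {set 'I_n}) (f g : grassmann n K).

(** The left partial derivative d/dx_j: the sign moves x_j to the front of the monomial before it is
    deleted. *)
Definition gr_partial j f : grassmann n K :=
  [ffun S : {set 'I_n} =>
     if j \in S then 0 else (-1) ^+ inversions [set j] S * f (j |: S)].

Lemma gr_partial_genM j i g : gr_partial j (gr_gen K i * g) =
  (j == i)%:R *: g - gr_gen K i * gr_partial j g.
Proof.
apply/ffunP => S; rewrite gr_addE gr_oppE gr_scaleE gr_genM [LHS]ffunE gr_genM.
rewrite [gr_partial j g _]ffunE !inE [j == i]eq_sym.
case: (eqVneq i j) => [->|neij] /=.
  case: ifP => jS.
    by rewrite mul1r mulrA -expr2 sqrr_sign setD1K // mul1r subrr.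
  by rewrite mul1r subr0 setU1K ?jS // mulrA -expr2 sqrr_sign mul1r.
rewrite mul0r add0r.
case: ifP => jS; first by rewrite mulr0 if_same oppr0.
case: ifP => iS; last by rewrite mulr0 oppr0.
have -> : (j |: S) :\ i = j |: (S :\ i).
  apply/setP => k; rewrite !inE; case: (eqVneq k j) => [->|] //=.
  by rewrite eq_sym neij.
have -> : inversions [set j] S = ((i < j) + inversions [set j] (S :\ i))%N.
  by rewrite -{1}(setD1K iS) inversionsUr ?inversions11 // disjoints1 !inE eqxx.
rewrite inversionsUr ?disjoints1 ?inE ?jS ?andbF // inversions11 !exprD.
move: (_ ^+ inversions _ _) (_ ^+ inversions _ _) (g _) => p q r.
(* Exactly one of i < j and j < i holds, so the two comparison signs multiply to -1, the sign of the
   skew Leibniz rule. *)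
by case: (ltngtP i j) neij => [_ _|_ _|/ord_inj ->]; rewrite ?eqxx // ?expr0
  ?expr1 ?mul1r ?mulN1r ?mulNr ?mulrN -?mulrA; congr (- _); rewrite mulrCA.
Qed.

(** d/dx_j is only a skew derivation; multiplying by the odd x_i makes it even, hence a genuine
    derivation. *)
Definition gr_shift i j f : grassmann n K := gr_gen K i * gr_partial j f.

Lemma gr_shift_is_linear i j : linear (gr_shift i j).
Proof.
move=> c f g; rewrite /gr_shift gr_scaleAr -mulrDr; congr (_ * _).
apply/ffunP => S; rewrite gr_addE gr_scaleE !ffunE.
by case: ifP => _; rewrite ?mulr0 ?addr0 // mulrDr mulrCA.
Qed.

HB.instance Definition _ i j :=
  GRing.isLinear.Build K (grassmann n K) (grassmann n K) *:%R (gr_shift i j)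
    (@gr_shift_is_linear i j).

(** Passing x_k costs one sign through d/dx_j and another through x_i; the two cancel, and for i = k
    the term dies by x_k^2 = 0. *)
Lemma gr_shift_genM i j k g : gr_shift i j (gr_gen K k * g) =
  (j == k)%:R *: (gr_gen K i * g) + gr_gen K k * gr_shift i j g.
Proof.
rewrite /gr_shift gr_partial_genM mulrBr -gr_scaleAr; congr (_ + _).
rewrite !mulrA; have [->|neik] := eqVneq i k.
  by rewrite gr_gen_sq mul0r oppr0.
by rewrite (gr_gen_anti _ neik) mulNr opprK.
Qed.

Lemma gr_shift1 i j : gr_shift i j 1 = 0.
Proof.
rewrite /gr_shift (_ : gr_partial j 1 = 0) ?mulr0 //; apply/ffunP => S.
rewrite !ffunE; case: ifP => // _; case: eqP => [/setP/(_ j)|_].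
  by rewrite !inE eqxx.
by rewrite mulr0.
Qed.

(** By linearity [f] may be taken to be a monomial; peeling off its least generator reduces the
    claim to the Leibniz rule for one generator. *)
Lemma gr_shift_derivation i j : is_derivation (gr_shift i j).
Proof.
move=> f g; rewrite (gr_expand f) !mulr_suml !linear_sum mulr_suml -big_split.
apply: eq_bigr => A _ /=; rewrite -!gr_scaleAl !linearZ /= -gr_scaleAl.
rewrite -scalerDr; congr (_ *: _).
elim/min_set_ind: A => [|k A ltkA IHA].
  by rewrite /gr_mon monomial0 gr_shift1 mul0r add0r !mul1r.
rewrite gr_mon_cons // -mulrA !gr_shift_genM IHA mulrDl mulrDr.
by rewrite -gr_scaleAl !mulrA addrA.
Qed.

Lemma gr_shiftii i f S : gr_shift i i f S = if i \in S then f S else 0.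
Proof.
rewrite gr_genM; case: ifP => // iS.
by rewrite ffunE !inE eqxx /= setD1K // mulrA -expr2 sqrr_sign mul1r.
Qed.

Lemma gr_shift_mon i j B : i \notin B -> j \notin B -> exists s : nat,
  gr_shift i j (gr_mon K (j |: B)) = (-1) ^+ s *: gr_mon K (i |: B).
Proof.
move=> niB njB.
rewrite gr_genM_mon // linearZ /= gr_shift_genM eqxx scale1r.
have -> : gr_shift i j (gr_mon K B) = 0.
  rewrite /gr_shift (_ : gr_partial j _ = 0) ?mulr0 //; apply/ffunP => S.
  rewrite !ffunE; case: ifP => // _; rewrite gr_monE.
  by case: eqP => [eB|]; rewrite ?mulr0 //; rewrite -eB !inE eqxx in njB.
rewrite mulr0 addr0 [gr_mon K (i |: B)]gr_genM_mon //.
exists (inversions [set j] B + inversions [set i] B)%N.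
rewrite exprD -scalerA; congr (_ *: _).
by rewrite scalerA -expr2 sqrr_sign scale1r.
Qed.

End PartialDerivatives.

(** * The degree filtration and the powers of the augmentation ideal *)

Section Filtration.
Variables (n : nat) (K : comPzRingType).
Implicit Types (i j : 'I_n) (A B S : {set 'I_n}) (f g : grassmann n K).

Definition gr_filtration (k : nat) : set (grassmann n K) :=
  [set f | forall S : {set 'I_n}, (#|S| < k)%N -> f S = 0].

(** If |S| < k + l, every subset A of S has |A| < k or |S \ A| < l. *)
Lemma gr_filtrationM k l f g :
  gr_filtration k f -> gr_filtration l g -> gr_filtration (k + l) (f * g).
Proof.
move=> fk gl S ltS; rewrite gr_mulE big1 // => A sAS.
have [/fk ->|leA] := ltnP #|A| k; first by rewrite mulr0 mul0r.
rewrite (gl (S :\: A)) ?mulr0 // cardsDS //.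
by rewrite ltn_subLR ?subset_leq_card // (leq_trans ltS) // leq_add2r.
Qed.

Lemma gr_filtrationD k f g :
  gr_filtration k f -> gr_filtration k g -> gr_filtration k (f + g).
Proof. by move=> fk gk S ltS; rewrite gr_addE fk ?gk ?addr0. Qed.

Lemma gr_mon_filtration A : gr_filtration #|A| (gr_mon K A).
Proof.
by move=> S; rewrite gr_monE; case: eqP => // ->; rewrite ltnn.
Qed.

Lemma gr_gen_filtration i : gr_filtration 1 (gr_gen K i).
Proof. by rewrite gr_genE -(cards1 i); apply: gr_mon_filtration. Qed.

Lemma derivation_gen_filtration (d : {linear grassmann n K -> grassmann n K}) i :
  (exists h : K, 2%:R * h = 1) -> is_derivation d ->
  gr_filtration 1 (d (gr_gen K i)).
Proof.
move=> [h h2] dM S; rewrite ltnS leqn0 cards_eq0 => /eqP ->.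
(* With c the constant term of d x_i, the coefficient of x_i in d(x_i) x_i + x_i d(x_i) = 0 is c +
   c, and [h] cancels the 2. *)
have /ffunP/(_ [set i]%SET) : d (gr_gen K i * gr_gen K i) = 0.
  by rewrite gr_gen_sq linear0.
rewrite dM gr_addE gr_genM inE eqxx setDv inversions0r mul1r.
have -> : (d (gr_gen K i) * gr_gen K i) [set i]%SET = d (gr_gen K i) set0%SET.
  rewrite gr_mulE (bigD1 set0%SET) ?sub0set //= inversions0l setD0 ffunE eqxx.
  rewrite mul1r mulr1 big1 ?addr0 // => A /andP[].
  rewrite subset1 => /orP[/eqP->|->//] _.
  rewrite setDv ffunE; case: eqP => [/setP/(_ i)|]; last by rewrite mulr0.
  by rewrite !inE eqxx.
rewrite ffunE -mulr2n -mulr_natl => e.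
by rewrite -[LHS]mul1r -h2 mulrAC e mul0r.
Qed.

(** Each Leibniz term replaces one x_i by d x_i, which has no constant term, so no degree is
    lost. *)
Lemma derivation_mon_filtration (d : {linear grassmann n K -> grassmann n K}) A :
  (exists h : K, 2%:R * h = 1) -> is_derivation d ->
  gr_filtration #|A| (d (gr_mon K A)).
Proof.
move=> h2 dM; elim/min_set_ind: A => [|i A ltiA IHA].
  by move=> S; rewrite cards0.
rewrite gr_mon_cons // cardsU1 disjoint1_lt // dM; apply: gr_filtrationD.
  apply: gr_filtrationM; last exact: gr_mon_filtration.
  exact: derivation_gen_filtration.
apply: gr_filtrationM => //.
exact: gr_gen_filtration.
Qed.

Lemma ideal_mulD (R : pzRingType) (a b : set R) (u v : R) :
  ideal_mul a b u -> ideal_mul a b v -> ideal_mul a b (u + v).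
Proof.
move=> [s sab ->] [t tab ->]; exists (s ++ t); last by rewrite big_cat.
by move=> p; rewrite mem_cat => /orP[/sab|/tab].
Qed.

Lemma augmentation_filtration : augmentation_ideal n K = gr_filtration 1.
Proof.
apply/seteqP; split=> f /=.
  move=> [c ->] S; rewrite ltnS leqn0 cards_eq0 => /eqP ->.
  rewrite sum_ffunE big1 // => A A1; rewrite gr_scaleE gr_monE.
  by case: eqP A1 => [<-|]; rewrite ?cards0 ?mulr0.
move=> f0; exists f; rewrite {1}(gr_expand f) (bigD1 set0%SET) //=.
rewrite f0 ?cards0 // scale0r add0r; apply: eq_bigl => A.
by rewrite lt0n cards_eq0.
Qed.

Lemma ideal_exp_augmentation k :
  ideal_exp (augmentation_ideal n K) k = gr_filtration k.
Proof.
elim: k => [|k IHk]; first by apply/seteqP; split.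
rewrite /ideal_exp iterS -/(ideal_exp _ k) IHk augmentation_filtration.
apply/seteqP; split=> f /=.
  move=> [s sab ->] S ltS; rewrite sum_ffunE big1_seq // => p /andP[_ /sab[p1 p2]].
  exact: gr_filtrationM p1 p2 S ltS.
move=> fk; rewrite (gr_expand f); apply: big_ind.
- by exists [::]; rewrite ?big_nil.
- exact: ideal_mulD.
move=> A _; have [/fk ->|ltkA] := ltnP #|A| k.+1.
  by exists [::]; rewrite ?big_nil ?scale0r.
have /card_gt0P[i iA] : (0 < #|A|)%N by apply: leq_trans ltkA.
have niA : i \notin A :\ i by rewrite !inE eqxx.
(* x^A is, up to sign, x_i times the monomial of A \ i: coefficient and sign go to the factor of
   degree one, and the other has degree |A| - 1 >= k. *)
exists [:: ((f A * (-1) ^+ inversions [set i] (A :\ i)) *: gr_gen K i,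
           gr_mon K (A :\ i))].
  move=> p; rewrite inE => /eqP -> /=; split=> S ltS.
    by rewrite gr_scaleE gr_gen_filtration ?mulr0.
  apply: gr_mon_filtration; apply: leq_trans ltS _.
  by rewrite -ltnS; rewrite (cardsD1 i) iA in ltkA.
by rewrite big_seq1 /= -gr_scaleAl -scalerA -gr_genM_mon // setD1K.
Qed.

End Filtration.

Arguments gr_filtration : clear implicits.

(** * From flags to differential ideals *)

Section Flags.
Variables (n : nat) (K : comPzRingType).
Implicit Types (i j : 'I_n) (A B S : {set 'I_n}) (f g : grassmann n K).
Implicit Types (I : 'I_n.+1 -> set K) (a : set (grassmann n K)).

Lemma flag_hatE I f :
  flag_hat n K I f <-> forall A, I (inord #|A|) (f A).
Proof.
split=> [[c cI ->] A|fI]; first by rewrite gr_sumE.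
by exists f => //; apply: gr_expand.
Qed.

Lemma card_set_ord A : (#|A| < n.+1)%N.
Proof. by rewrite ltnS -[X in (_ <= X)%N]card_ord max_card. Qed.

Lemma flag_le I A B (c : K) : is_flag n K I -> (#|A| <= #|B|)%N ->
  I (inord #|A|) c -> I (inord #|B|) c.
Proof.
by move=> [_ Imono] leAB; apply: Imono; rewrite !inordK // card_set_ord.
Qed.

(** The coefficient of x^S in a product only involves coefficients at subsets A of S, and I_|A| lies
    in I_|S|. *)
Lemma flag_hat_ideal I : is_flag n K I -> is_ideal (flag_hat n K I).
Proof.
move=> If; have [Iid _] := If.
split=> [|f g /flag_hatE fI /flag_hatE gI|r f /flag_hatE fI].
- by apply/flag_hatE => A; rewrite ffunE; case: (Iid (inord #|A|)).
- apply/flag_hatE => A; rewrite gr_addE; case: (Iid (inord #|A|)) => _ ID _.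
  exact: ID.
split; apply/flag_hatE => S; rewrite gr_mulE; apply: is_ideal_sum => // A sAS.
  case: (Iid (inord #|S|)) => _ _ IM; apply: (IM _ _ _).1.
  by apply: flag_le (fI _) => //; rewrite subset_leq_card ?subsetDl.
case: (Iid (inord #|S|)) => _ _ IM; apply: (IM _ _ _).2; apply: (IM _ _ _).1.
by apply: flag_le (fI _) => //; rewrite subset_leq_card.
Qed.

(** The coefficient of x^S in f_A d(x^A) is 0 when |S| < |A|; otherwise it lies in I_|A|, hence in
    I_|S|. *)
Lemma flag_hat_differential I : (exists h : K, 2%:R * h = 1) ->
  is_flag n K I -> differential_ideal n K (flag_hat n K I).
Proof.
move=> h2 If; split; first exact: flag_hat_ideal.
have [Iid _] := If.
move=> d dM _ [f /flag_hatE fI <-]; apply/flag_hatE => S.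
rewrite (gr_expand f) linear_sum sum_ffunE; apply: is_ideal_sum => // A _.
rewrite linearZ gr_scaleE.
case: (Iid (inord #|S|)) => I0 _ IM.
have [ltSA|leAS] := ltnP #|S| #|A|.
  by rewrite (derivation_mon_filtration h2 dM) // mulr0.
by apply: (IM _ _ _).2; apply: flag_le (fI A).
Qed.

Lemma exists_card_set (k : 'I_n.+1) : exists A, #|A| = k :> nat.
Proof.
have : (0 < #|[set A : {set 'I_n} | #|A| == k]%SET|)%N.
  by rewrite card_draws card_ord bin_gt0 -ltnS.
by move=> /card_gt0P[A]; rewrite inE => /eqP; exists A.
Qed.

Lemma flag_hat_mon I A (c : K) : is_flag n K I ->
  flag_hat n K I (c *: gr_mon K A) <-> I (inord #|A|) c.
Proof.
move=> [Iid _]; split=> [/flag_hatE/(_ A)|cI].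
  by rewrite gr_scaleE gr_monE eqxx mulr1.
apply/flag_hatE => S; rewrite gr_scaleE gr_monE.
case: eqP => [->|_]; first by rewrite mulr1.
by rewrite mulr0; case: (Iid (inord #|S|)).
Qed.

(** I_k is recovered as the set of c with c x^A in the image, for any A of size k; such an A exists
    since k <= n. *)
Lemma flag_hat_inj :
  {in [set I | is_flag n K I] &, injective (flag_hat n K)}.
Proof.
move=> I J /set_mem If /set_mem Jf eIJ; apply/funext => k.
have [A Ak] := exists_card_set k.
have -> : k = inord #|A| by rewrite Ak inord_val.
apply/seteqP; split=> c /(flag_hat_mon _ _ _).2.
  by move=> /(_ If); rewrite eIJ => /(flag_hat_mon _ _ Jf).1.
by move=> /(_ Jf); rewrite -eIJ => /(flag_hat_mon _ _ If).1.
Qed.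

(** * From differential ideals to flags *)

Lemma differential_ideal_shift a i j f : differential_ideal n K a ->
  a f -> a (gr_shift i j f).
Proof.
by move=> [_ ad] af; apply: (ad (gr_shift i j) (gr_shift_derivation i j)); exists f.
Qed.

(** For each i in [s], apply x_i d/dx_i if i is in A and 1 - x_i d/dx_i otherwise: this keeps the
    monomials that agree with A at i. *)
Lemma differential_ideal_restrict a f A (s : seq 'I_n) : differential_ideal n K a ->
  a f -> a [ffun S : {set 'I_n} =>
              if all (fun i => (i \in S) == (i \in A)) s then f S else 0].
Proof.
move=> ad af; elim: s => [|i s /=].
  by congr (a _): af; apply/ffunP => S; rewrite ffunE.
set g := finfun _ => ag; have [aid _] := ad; have [_ aD _] := aid.
have ah := differential_ideal_shift i i ad ag.
have [iA|iA] := boolP (i \in A).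
  congr (a _): ah; apply/ffunP => S; rewrite gr_shiftii !ffunE.
  by case: (i \in S).
have := aD _ _ ag (is_ideal_opp aid ah); congr (a _); apply/ffunP => S.
rewrite gr_addE gr_oppE gr_shiftii !ffunE.
by case: (i \in S); rewrite /= ?subrr ?subr0.
Qed.

Lemma differential_ideal_term a f A : differential_ideal n K a ->
  a f -> a (f A *: gr_mon K A).
Proof.
move=> ad /(differential_ideal_restrict A (enum 'I_n) ad); congr (a _).
apply/ffunP => S; rewrite ffunE gr_scaleE gr_monE.
have -> : all (fun i => (i \in S) == (i \in A)) (enum 'I_n) = (S == A).
  apply/allP/eqP => [eSA|-> //]; apply/setP => i.
  by apply/eqP/eSA; rewrite mem_enum.
by case: eqP => [->|_]; rewrite ?mulr1 ?mulr0.
Qed.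

Lemma differential_ideal_swap a (c : K) i j B : differential_ideal n K a ->
  i \notin B -> j \notin B ->
  a (c *: gr_mon K (j |: B)) -> a (c *: gr_mon K (i |: B)).
Proof.
move=> ad niB njB /(differential_ideal_shift i j ad); have [aid _] := ad.
have [s e] := gr_shift_mon K niB njB; rewrite linearZ /= e.
rewrite scalerA mulrC -signr_odd; case: odd; last by rewrite mul1r.
rewrite mulN1r scaleNr => /(is_ideal_opp aid); by rewrite opprK.
Qed.

(** Induction on |A \ B|: x_i d/dx_j exchanges some j in A \ B for some i in B \ A, which exists
    because the cardinals agree. *)
Lemma differential_ideal_card a (c : K) A B : differential_ideal n K a ->
  #|A| = #|B| -> a (c *: gr_mon K A) -> a (c *: gr_mon K B).
Proof.
move=> ad; have [m] := ubnP #|A :\: B|; elim: m A => // m IHm A ltm eAB aA.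
have [/eqP|[j]] := set_0Vmem (A :\: B).
  rewrite setD_eq0 => sAB; suff <- : A = B by [].
  by apply/eqP; rewrite eqEcard sAB eAB leqnn.
rewrite inE => /andP[jB jA].
have [|[i]] := set_0Vmem (B :\: A).
  move=> /eqP; rewrite setD_eq0 => sBA.
  have /eqP eBA : B == A by rewrite eqEcard sBA eAB leqnn.
  by rewrite eBA jA in jB.
rewrite inE => /andP[iA iB].
have niA : i \notin A :\ j by rewrite !inE (negPf iA) andbF.
apply: (IHm (i |: A :\ j)).
- rewrite -ltnS; apply: leq_trans ltm; rewrite ltnS; apply: proper_card.
  apply/properP; split.
    apply/subsetP => k; rewrite !inE => /andP[kB /orP[/eqP ek|/andP[_ ->]]].
      by rewrite ek iB in kB.
    by rewrite kB.
  by exists j; rewrite !inE ?jB ?jA // eqxx orbF /=; apply: contraNneq iA => <-.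
- by rewrite cardsU1 niA -eAB [in RHS](cardsD1 j) jA.
- apply: (@differential_ideal_swap _ _ _ j) => //; first by rewrite !inE eqxx.
  by rewrite setD1K.
Qed.

(** Multiplying by generators outside A raises the degree one at a time, until
    [differential_ideal_card] applies. *)
Lemma differential_ideal_card_le a (c : K) A B : differential_ideal n K a ->
  (#|A| <= #|B|)%N -> a (c *: gr_mon K A) -> a (c *: gr_mon K B).
Proof.
move=> ad; have [m] := ubnP (#|B| - #|A|)%N; elim: m A => // m IHm A ltm.
rewrite leq_eqVlt => /orP[/eqP|ltAB]; first exact: differential_ideal_card.
have [i iA] : exists i, i \notin A.
  have : (0 < #|~: A|)%N.
    rewrite -(ltn_add2l #|A|) addn0 cardsC card_ord.
    by rewrite (leq_trans ltAB) // -ltnS card_set_ord.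
  by move=> /card_gt0P[i]; rewrite inE; exists i.
move=> aA; have cU : #|i |: A| = #|A|.+1 by rewrite cardsU1 iA.
apply: (IHm (i |: A)); rewrite ?cU //.
  by rewrite subnS -ltnS prednK ?subn_gt0.
have [[_ _ aM] _] := ad.
rewrite gr_genM_mon // scalerA mulrC -scalerA gr_scaleAr gr_scaleAl.
exact: (aM _ _ aA).1.
Qed.

Lemma differential_ideal_flag a : differential_ideal n K a ->
  exists2 I, is_flag n K I & flag_hat n K I = a.
Proof.
move=> ad; have [[a0 aD aM] _] := ad.
(* Quantifying over all A of size k avoids choosing a representative; by [differential_ideal_card] a
   single A suffices to test membership. *)
pose I (k : 'I_n.+1) : set K :=
  [set c | forall A, #|A| = k :> nat -> a (c *: gr_mon K A)].
exists I.
  split=> [k|k l lekl c cI B Bl]; last first.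
    have [A Ak] := exists_card_set k.
    by apply: differential_ideal_card_le (cI A Ak); rewrite // Ak Bl.
  split=> [A _|u v uI vI A Ak|r u uI].
  - by rewrite scale0r.
  - by rewrite scalerDl; apply: aD; [apply: uI | apply: vI].
  suff rI : I k (r * u) by split=> //; rewrite mulrC.
  move=> A /uI /(aM (r *: (1 : grassmann n K))) [+ _].
  by rewrite -gr_scaleAl mul1r scalerA.
apply/seteqP; split=> f.
  move=> /flag_hatE fI; rewrite (gr_expand f); apply: is_ideal_sum => [|A _].
    by case: ad.
  by apply: fI; rewrite inordK // card_set_ord.
move=> af; apply/flag_hatE => A B; rewrite inordK ?card_set_ord // => eBA.
by apply: differential_ideal_card (differential_ideal_term A ad af).
Qed.

(** The flag is 0 below index k and all of K from k on. *)
Lemma gr_filtration_flag k :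
  exists2 I, is_flag n K I & flag_hat n K I = gr_filtration n K k.
Proof.
exists (fun l => [set c | (l < k)%N -> c = 0]).
  split=> [l|l m lelm c c0 ltm]; last by apply: c0; apply: leq_ltn_trans ltm.
  split=> //= [u v u0 v0 ltl|r u u0]; first by rewrite u0 ?v0 ?addr0.
  by split=> /u0 ->; rewrite ?mulr0 ?mul0r.
by apply/seteqP; split=> f; [move=> /flag_hatE fI S|move=> fk; apply/flag_hatE => S];
  have := card_set_ord S => /inordK e; [have := fI S|have := fk S]; rewrite /= e.
Qed.

End Flags.

(** * Differential ideals over a field *)

Lemma field_differential_ideal (n : nat) (K : fieldType)
    (a : set (grassmann n K)) : differential_ideal n K a ->
  exists2 k : nat, (k <= n.+1)%N & a = gr_filtration n K k.
Proof.
move=> /differential_ideal_flag[I [Iid Imono] <-].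
(* Each I_l is thus 0 or K, so the flag is determined by the first index at which it contains 1. *)
have I1 l c : I l c -> c != 0 -> I l 1.
  move=> cI c0; case: (Iid l) => _ _ /(_ c^-1 _ cI)[+ _].
  by rewrite mulVf.
(* The value n + 1 stands for the zero flag; as it always satisfies [P], the minimum never reaches
   larger m, where [inord] takes its default value. *)
pose P (m : nat) := (m == n.+1) || `[< I (inord m) 1 >].
have exP : exists m, P m by exists n.+1; rewrite /P eqxx.
case: (ex_minnP exP) => k Pk kmin; exists k.
  by apply: kmin; rewrite /P eqxx.
apply/seteqP; split=> f.
  move=> /flag_hatE fI S ltSk; apply/eqP; apply: contraTT ltSk => fS0.
  by rewrite -leqNgt; apply: kmin; apply/orP; right; apply/asboolP; apply: I1 fS0.
move=> fk; apply/flag_hatE => S; case: (Iid (inord #|S|)) => I0 _ IM.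
have [/fk ->//|lekS] := ltnP #|S| k.
rewrite -[f S]mulr1; apply: (IM _ _ _).1.
have ltS := card_set_ord S; have ltk := leq_ltn_trans lekS ltS.
case/orP: Pk => [/eqP ek|/asboolP]; first by rewrite ek ltnn in ltk.
by apply: Imono; rewrite !inordK.
Qed.

Theorem proposition2p6 (n : nat) (hn : (1 <= n)%N) :
  (forall K : comPzRingType, (exists h : K, 2%:R * h = 1) ->
     set_bij [set I | is_flag n K I] [set a | differential_ideal n K a]
       (flag_hat n K)
     /\ forall i : nat, (i <= n.+1)%N ->
          differential_ideal n K (ideal_exp (augmentation_ideal n K) i))
  /\ (forall K : fieldType, 2%N \notin [pchar K] ->
        forall a : set (grassmann n K), differential_ideal n K a ->
          exists2 i : nat, (i <= n.+1)%N
            & a = ideal_exp (augmentation_ideal n K) i).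
Proof.
split=> [K h2|K _ a /field_differential_ideal[k lek ->]]; last first.
  by exists k; rewrite ?ideal_exp_augmentation.
split; last first.
  move=> i _; rewrite ideal_exp_augmentation.
  have [I If <-] := gr_filtration_flag n K i.
  exact: flag_hat_differential.
split; last 1 first.
- by move=> a /= /differential_ideal_flag[I If <-]; exists I.
- by move=> I /= If; apply: flag_hat_differential.
- exact: flag_hat_inj.
Qed.
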